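(* Let $r\ge 2$ be an integer and let $G_r$ be the triple block graph $Pt_2(r,r)$. Then the second largest eigenvalue of the distance matrix $\mathbf{D}(G_r)$ is less than $-1/2$.
   Context: For a finite simple connected graph $G$ with vertices $v_1,\dots,v_n$, $d_G(u,v)$ is the length of a shortest path between $u$ and $v$, and the distance matrix is $\mathbf{D}(G)=[d_G(v_i,v_j)]$; its real eigenvalues are ordered decreasingly, counted with multiplicity. A block of a graph is a maximal connected subgraph that has no cut vertex. The diamond is $K_4$ minus one edge. The full house is the 5-vertex graph consisting of a $K_4$ together with one further vertex adjacent to exactly two vertices of the $K_4$. Each of these two graphs has exactly one minimal vertex separator (mvs), of cardinality $2$: in the diamond, the two vertices of degree $3$; in the full house, the two vertices of degree $4$. For integers $p,q\ge 2$, a triple block graph $Pt_2(p,q)$ is a graph with exactly three blocks: one is a full house (or a diamond), the other two are cliques $K_p$ and $K_q$, and these two cliques are attached to the full house (or diamond) at the two distinct vertices of its mvs of cardinality $2$: $K_p$ shares with it exactly one of these two vertices and $K_q$ shares with it exactly the other one. *)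

(* Defs.v *)
From mathcomp Require Import all_boot all_order all_algebra.
From mathcomp Require Import polyrcf.

Set Implicit Arguments.
Unset Strict Implicit.
Unset Printing Implicit Defensive.

Import Order.TTheory GRing.Theory Num.Theory.

Local Open Scope ring_scope.

Section Graph.

Variables (T : finType) (e : rel T).
Implicit Types (S B M : {set T}) (x y a b : T).

Definition conn_graph : bool := [forall x, forall y, connect e x y].

(* A path of a graph on T has fewer than #|T| edges, so only those lengths are
   searched; the value is the junk #|T| when x and y are not connected. *)
Definition gdist x y : nat :=
  find (fun k => [exists p : k.-tuple T,
                    [&& path e x p, uniq (x :: p) & last x p == y]])
       (iota 0 #|T|).

(* Edges of the subgraph induced by S. *)
Definition induced S : rel T := [rel x y | [&& x \in S, y \in S & e x y]].

Definition conn_in S : bool :=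
  (S != set0) && [forall x in S, forall y in S, connect (induced S) x y].

(* x is a cut vertex of the subgraph induced by S: deleting x disconnects two
   vertices that were connected. *)
Definition cut_vertex S x : bool :=
  (x \in S) &&
  [exists a in S :\ x, exists b in S :\ x,
     connect (induced S) a b && ~~ connect (induced (S :\ x)) a b].

(* A block is determined by its vertex set: adding edges to a connected graph
   creates no cut vertex, so a maximal subgraph of this kind is induced. *)
Definition block : pred {set T} :=
  maxset (fun S => conn_in S && [forall x, ~~ cut_vertex S x]).

Definition separator B a b M : bool :=
  [&& a \in B :\: M, b \in B :\: M, M \subset B, connect (induced B) a b
    & ~~ connect (induced (B :\: M)) a b].

(* Minimal vertex separators are minimal for some pair of vertices. *)
Definition mvs B M : bool :=
  [exists a, exists b, minset (separator B a b) M].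

(* The subgraph induced by S is isomorphic to the graph g. *)
Definition induces (U : finType) (g : rel U) S : Prop :=
  exists f : U -> T,
    [/\ injective f, S = [set f u | u : U] & forall u v, e (f u) (f v) = g u v].

End Graph.

Definition complete p : rel 'I_p := [rel i j | i != j].

(* K_4 minus the edge {2, 3}. *)
Definition diamond : rel 'I_4 :=
  [rel i j : 'I_4 | (i != j) && (minn i j < 2)%N].

(* K_4 on {0, 1, 2, 3}, and the vertex 4 adjacent to 0 and 1. *)
Definition full_house : rel 'I_5 :=
  [rel i j : 'I_5 | (i != j) && ((maxn i j < 4)%N || (minn i j < 2)%N)].

(* The triple block graphs Pt_2(p, q), with a full house or a diamond B. *)
Definition Pt2 (T : finType) (e : rel T) (p q : nat) : Prop :=
  exists B K L : {set T},
    [/\ uniq [:: B; K; L],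
        [set S | block e S] = [set B; K; L],
        induces e full_house B \/ induces e diamond B,
        induces e (@complete p) K /\ induces e (@complete q) L
      & exists u v : T,
          [/\ u != v, mvs e B [set u; v], B :&: K = [set u]
            & B :&: L = [set v]]].

Definition distmx (R : pzRingType) n (e : rel 'I_n) : 'M[R]_n :=
  \matrix_(i, j) (gdist e i j)%:R.

(* Real eigenvalues in decreasing order, each repeated according to its
   multiplicity as a root of the characteristic polynomial. *)
Definition eigenvalues (R : rcfType) n (A : 'M[R]_n) : seq R :=
  sort >=%R (flatten [seq nseq (mup x (char_poly A)) x
                     | x <- rootsR (char_poly A)]).

(* Main.v *)
Require Import Defs.
From mathcomp Require Import all_boot all_order all_algebra.
From mathcomp Require Import ring lra polyrcf complex spectral sesquilinear.

Set Implicit Arguments.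
Unset Strict Implicit.

Import Order.TTheory GRing.Theory Num.Theory.
Local Open Scope ring_scope.

(* Write u, v for the two separator vertices and B for the full house or
   diamond. For a vector z, let p and q be its sums over the two cliques without
   u and v. Since distinct vertices of one clique other than u and v are twins,
   z D z^T is a quadratic form in p, q and the values of z on B, minus the sum of
   the squares of z off B. Up to nonpositive multiples of these squares,
   z (D + 1/2) z^T equals h^2 / 8 minus a sum of squares, where
   h = 4 (p + q) + 3 (z_u + z_v) + 4 s and s is the sum of z over the rest of B.
   So D + 1/2 is negative definite on the hyperplane h = 0. Eigenvectors for
   two eigenvalues that are at least -1/2 would span a plane on which D + 1/2 is
   nonnegative, and this plane meets the hyperplane. *)

(** * Spectral theory of real symmetric matrices *)

Lemma char_poly_conj (F : comNzRingType) n (P Q M : 'M[F]_n) :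
  P *m Q = 1%:M -> char_poly (Q *m M *m P) = char_poly M.
Proof.
move=> PQ; have QP := mulmx1C PQ.
have PQX : map_mx polyC P *m map_mx polyC Q = 1%:M.
  by rewrite -map_mxM PQ map_mx1.
have -> : char_poly (Q *m M *m P) =
    \det (map_mx polyC Q *m char_poly_mx M *m map_mx polyC P).
  rewrite /char_poly /char_poly_mx; congr (\det _).
  have QXP : map_mx polyC Q *m 'X%:M *m map_mx polyC P = 'X%:M.
    by rewrite scalar_mxC -mulmxA -map_mxM QP map_mx1 mulmx1.
  by rewrite mulmxBr mulmxBl QXP -!map_mxM.
by rewrite !det_mulmx mulrC mulrA -det_mulmx PQX det1 mul1r.
Qed.

Section Spectral.
Variable R : rcfType.

(** Both lists are compared by counting each [x]. The roots in [rootsR] are distinct, so only the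
    block of [x] itself contributes, with [mup x] copies; for a non-root both counts are zero. *)
Lemma perm_eigenvalues n (A : 'M[R]_n) (s : seq R) :
  char_poly A = \prod_(x <- s) ('X - x%:P) -> perm_eq (eigenvalues A) s.
Proof.
move=> As; rewrite /eigenvalues perm_sort; apply/allP => x _ /=.
have pn0 : char_poly A != 0 by rewrite monic_neq0 ?char_poly_monic.
rewrite count_flatten -!map_comp.
rewrite (eq_map (g := fun y => (y == x) * mup y (char_poly A))%N); last first.
  by move=> y /=; rewrite count_nseq.
rewrite sumnE big_map -mu_prod_XsubC -As.
have [xr|xr] := boolP (x \in rootsR (char_poly A)).
  rewrite (bigD1_seq x) ?uniq_roots //= eqxx mul1n big1 ?addn0 //.
  by move=> y /negPf ->.
rewrite big1_seq; last first.
  move=> y /= yr; case: eqP => // yx; by rewrite -yx yr in xr.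
rewrite mupNroot //; apply: contra xr => xr.
by rewrite -(roots_on_rootsR pn0) xr.
Qed.

(** The cross terms between [a] and [b] are purely imaginary because [A] is real. *)
Lemma Re_hermitian_form n (A : 'M[R]_n) (v : 'rV[R[i]]_n) :
  let a := map_mx (@complex.Re R) v in let b := map_mx (@complex.Im R) v in
  complex.Re ((v *m map_mx (real_complex R) A *m map_mx Num.conj v^T) 0 0) =
  (a *m A *m a^T) 0 0 + (b *m A *m b^T) 0 0.
Proof.
move=> a b; rewrite !mxE (raddf_sum (@complex.Re R : Rcomplex R -> R)).
rewrite -big_split; apply: eq_bigr => j _ /=.
rewrite !mxE !big_distrl /= (raddf_sum (@complex.Re R : Rcomplex R -> R)).
rewrite -big_split; apply: eq_bigr => k _ /=.
rewrite !mxE; case: (v 0 j) => c d; case: (v 0 k) => c' d' /=.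
ring.
Qed.

(** Over [R[i]] the matrix is hermitian, hence unitarily diagonalizable with real spectrum. *)
Lemma sym_spectral n (A : 'M[R]_n) : A^T = A ->
  exists (P : 'M[R[i]]_n) (x : 'I_n -> R),
    [/\ P *m map_mx Num.conj P^T = 1%:M,
        map_mx (real_complex R) A =
          map_mx Num.conj P^T *m diag_mx (\row_k (x k)%:C%C) *m P &
        char_poly A = \prod_(k < n) ('X - (x k)%:P)].
Proof.
move=> symA; set AC := map_mx (real_complex R) A.
have hA : AC \is hermsymmx.
  apply/is_hermitianmxP; rewrite expr0 scale1r; apply/matrixP => j k.
  rewrite !mxE -{1}symA mxE; apply/esym/CrealP/complex_realP; by exists (A k j).
have /orthomx_spectralP Aspec := hermitian_normalmx hA.
set P := spectralmx AC in Aspec.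
have Pu : P \is unitarymx by exact: spectral_unitarymx.
exists P, (fun k => complex.Re (spectral_diag AC 0 k)).
have dE : \row_k (complex.Re (spectral_diag AC 0 k))%:C%C = spectral_diag AC.
  apply/rowP => k; rewrite mxE RRe_real //.
  exact: (mxOverP (hermitian_spectral_diag_real hA)).
split; first exact/unitarymxP.
  by rewrite dE [LHS]Aspec invmx_unitary.
(* The factorization is proved over [R[i]] and descends because the embedding of [R] is injective on
   polynomials. *)
apply: (map_poly_inj (real_complex R)).
have {}Aspec : char_poly AC = char_poly (diag_mx (spectral_diag AC)).
  by rewrite {1}Aspec char_poly_conj ?mulmxV ?spectral_unit.
rewrite map_char_poly -/AC Aspec -dE.
rewrite char_poly_trig ?diag_mx_is_trig // rmorph_prod.
by apply: eq_bigr => k _; rewrite rmorphB /= map_polyX map_polyC !mxE eqxx.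
Qed.

(** If the entry at index 1 reached [c], so would the one before it. The size bound keeps index 1
    away from the default value 0. *)
Lemma sorted_ge_nth1 (s : seq R) (c : R) :
  sorted >=%R s -> (1 < size s)%N -> (count (fun x => (c <= x)%R) s <= 1)%N ->
  s`_1 < c.
Proof.
case: s => [|x [|y t]] //= /andP[xy _] _; rewrite ltNge; apply: contraTN => cy.
by rewrite cy (le_trans cy xy).
Qed.

(** One half of the Courant-Fischer principle. The eigenvectors at hand are complex, so the vector
    found in their plane is split into real and imaginary parts, to which the real hypothesis
    applies. *)
Theorem second_eigenvalue_lt n (A : 'M[R]_n) (w : 'cV[R]_n) (c : R) :
  (1 < n)%N -> A^T = A ->
  (forall x : 'rV[R]_n, x != 0 -> x *m w = 0 ->
     (x *m A *m x^T) 0 0 < c * (x *m x^T) 0 0) ->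
  (eigenvalues A)`_1 < c.
Proof.
move=> n1 symA Aw; have [P [x [PP AP cA]]] := sym_spectral symA.
have ev : perm_eq (eigenvalues A) [seq x k | k <- enum 'I_n].
  by apply: perm_eigenvalues; rewrite cA big_map big_enum.
apply: sorted_ge_nth1.
- by apply: sort_sorted => y z; exact: le_total.
- by rewrite (perm_size ev) size_map size_enum_ord.
rewrite (permP ev) count_map -size_filter leqNgt.
have -> : size [seq k <- enum 'I_n | preim x (fun y => (c <= y)%R) k] =
   #|[pred k | (c <= x k)%R]|.
  by rewrite cardE enumT; congr size; apply: eq_filter.
apply/negP => /card_gt1P[j [k [/[!inE] cj ck jk]]].
(* Orthogonality to [w] is one linear equation in the two coefficients [al] and [be], so it has a
   nonzero solution. *)
pose p i := (row i P *m map_mx (real_complex R) w) 0 0.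
have [al [be [ab0 abp]]] : exists al be : R[i],
    (al != 0) || (be != 0) /\ al * p j + be * p k = 0.
  have [pj|pj] := eqVneq (p j) 0.
    by exists 1, 0; rewrite oner_eq0 pj mulr0 mul0r addr0.
  by exists (- p k), (p j); rewrite pj orbT mulNr mulrC addNr.
(* [y *m P] is orthogonal to [w] and in the span of two eigenvectors. *)
pose y : 'rV[R[i]]_n := al *: delta_mx 0 j + be *: delta_mx 0 k.
have yE (d : 'rV[R[i]]_n) :
    (y *m diag_mx d *m map_mx Num.conj y^T) 0 0 =
    d 0 j * `|al| ^+ 2 + d 0 k * `|be| ^+ 2.
  rewrite mul_mx_diag mxE (bigD1 j) //= (bigD1 k) /= 1?eq_sym // big1.
    rewrite !mxE !eqxx (negPf jk) [k == j]eq_sym (negPf jk) /= !mulr1 !mulr0.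
    by rewrite addr0 add0r addr0 !normCK ![_ * d _ _]mulrC -!mulrA.
  move=> i /andP[ij ik]; rewrite !mxE (negPf ij) (negPf ik) /= !mulr0 addr0.
  by rewrite !mul0r.
pose v := y *m P.
have yv : y = v *m map_mx Num.conj P^T by rewrite -mulmxA PP mulmx1.
(* Unitarity of [P] recovers [y] from [v], and the entries of [y] at [j] and [k] are [al] and
   [be]. *)
have v0 : v != 0.
  apply: contraTneq ab0 => v0; rewrite -negb_and negbK.
  move: yv; rewrite v0 mul0mx => /rowP y0.
  have:= y0 j; have:= y0 k; rewrite !mxE !eqxx (negPf jk) eq_sym (negPf jk) /=.
  by rewrite !mulr0 !mulr1 add0r addr0 => -> ->; rewrite eqxx.
have vw : v *m map_mx (real_complex R) w = 0.
  apply/matrixP => i1 i2; rewrite !ord1 /v -mulmxA mulmxDl -!scalemxAl -!rowE.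
  by rewrite !row_mul mxE [X in X + _]mxE [X in _ + X]mxE abp mxE.
clearbody v y.
pose a := map_mx (@complex.Re R) v; pose b := map_mx (@complex.Im R) v.
have aw : a *m w = 0.
  apply/matrixP => i1 i2; rewrite !ord1; move/matrixP/(_ 0 0): vw.
  rewrite !mxE => /(congr1 (@complex.Re R)); rewrite
    (raddf_sum (@complex.Re R : Rcomplex R -> R)) => e.
  apply: etrans e; apply: eq_bigr => i _; rewrite /a /b !mxE.
  by case: (v 0 i) => ? ? /=; rewrite mulr0 subr0.
have bw : b *m w = 0.
  apply/matrixP => i1 i2; rewrite !ord1; move/matrixP/(_ 0 0): vw.
  rewrite !mxE => /(congr1 (@complex.Im R)); rewrite
    (raddf_sum (@complex.Im R : Rcomplex R -> R)) => e.
  apply: etrans e; apply: eq_bigr => i _; rewrite /a /b !mxE.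
  by case: (v 0 i) => ? ? /=; rewrite mulr0 add0r.
have form (B : 'M[R]_n) :
    complex.Re ((v *m map_mx (real_complex R) B *m map_mx Num.conj v^T) 0 0) =
    (a *m B *m a^T) 0 0 + (b *m B *m b^T) 0 0 := Re_hermitian_form B v.
have yvC : map_mx Num.conj y^T = P *m map_mx Num.conj v^T.
  rewrite yv trmx_mul map_mxM map_trmx trmxK -map_mx_comp.
  by congr (_ *m _); apply/matrixP => ? ?; rewrite !mxE /= conjCK.
have vA : v *m map_mx (real_complex R) A *m map_mx Num.conj v^T =
   y *m diag_mx (\row_k (x k)%:C%C) *m map_mx Num.conj y^T.
  by rewrite AP yvC yv !mulmxA.
have vv : v *m map_mx (real_complex R) 1%:M *m map_mx Num.conj v^T =
    y *m diag_mx (const_mx 1) *m map_mx Num.conj y^T.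
  by rewrite map_mx1 mulmx1 diag_const_mx mulmx1 yvC yv -mulmxA
    [_ *m (P *m _)]mulmxA (mulmx1C PP) mul1mx.
have F (z : 'rV[R]_n) : z *m w = 0 -> 
   (z *m A *m z^T) 0 0 <= c * (z *m z^T) 0 0.
  have [->|z0 zw] := eqVneq z 0; first by rewrite !mul0mx !mxE mulr0.
  exact/ltW/Aw.
pose N (z : R[i]) := complex.Re z ^+ 2 + complex.Im z ^+ 2.
have N0 z : 0 <= N z by rewrite addr_ge0 ?sqr_ge0.
have fA : (a *m A *m a^T) 0 0 + (b *m A *m b^T) 0 0 = x j * N al + x k * N be.
  rewrite -form vA yE [X in X * _ + _]mxE [X in _ + X * _]mxE -!add_Re2_Im2.
  by rewrite -!rmorphM -rmorphD.
have f1 : (a *m a^T) 0 0 + (b *m b^T) 0 0 = N al + N be.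
  have := form 1%:M; rewrite vv yE !mulmx1 => <-.
  rewrite [X in X * _ + _]mxE [X in _ + X * _]mxE -!add_Re2_Im2 !mul1r.
  by rewrite -rmorphD.
(* One of [a] and [b] is nonzero and gives strictness; [cj] and [ck] then give the opposite
   inequality. *)
have : x j * N al + x k * N be < c * (N al + N be).
  have [a0|a0] := eqVneq a 0; last first.
    by rewrite -fA -f1 mulrDr ltr_leD ?Aw ?F.
  have [b0|b0] := eqVneq b 0; last first.
    by rewrite -fA -f1 mulrDr ler_ltD ?Aw ?F.
  case/eqP: v0; apply/rowP => i; rewrite mxE; move/rowP/(_ i): a0.
  by move/rowP/(_ i): b0; rewrite !mxE; case: (v 0 i) => ? ? /= -> ->.
by apply/negP; rewrite -leNgt mulrDr; apply: lerD; apply: ler_wpM2r.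
Qed.
End Spectral.

(** * Certificates for small graph distances *)

Section Distance.
Variables (T : finType) (e : rel T).
Hypotheses (e_sym : symmetric e) (e_irr : irreflexive e).
Implicit Types x y z t : T.

(** A duplicate-free path has fewer than [#|T|] edges, so the search in [gdist] reaches [size p];
    minimality of [p] rules out an earlier hit. *)
Lemma gdist_shortest x p :
  path e x p -> uniq (x :: p) ->
  (forall q, path e x q -> last x q = last x p -> (size p <= size q)%N) ->
  gdist e x (last x p) = size p.
Proof.
move=> xp up minp; rewrite /gdist; set P := (X in find X).
have szp : (size p < #|T|)%N.
  by have := max_card (mem (x :: p)); rewrite (card_uniqP up).
have Pp : P (size p).
  by apply/existsP; exists (in_tuple p); rewrite xp up eqxx.
have hasP : has P (iota 0 #|T|).
  by apply/hasP; exists (size p) => //; rewrite mem_iota.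
set k := find _ _.
have kT : (k < #|T|)%N by rewrite -[#|T|](size_iota 0) -has_find.
apply/eqP; rewrite eqn_leq; apply/andP; split.
  rewrite leqNgt; apply/negP => /(before_find 0%N).
  by rewrite nth_iota // add0n Pp.
have := nth_find 0%N hasP; rewrite -/k nth_iota // add0n.
case/existsP=> q /and3P[xq _ /eqP ql].
by rewrite -(size_tuple q); exact: minp.
Qed.

(** Path reversal makes the two searches agree at every length, so the equality covers unconnected
    vertices too. *)
Lemma gdist_sym x y : gdist e x y = gdist e y x.
Proof.
suff sub u v k : [exists p : k.-tuple T,
      [&& path e u p, uniq (u :: p) & last u p == v]] ->
    [exists p : k.-tuple T, [&& path e v p, uniq (v :: p) & last v p == u]].
  by apply: eq_find => k; apply/idP/idP; exact: sub.
case/existsP=> p /and3P[up unp /eqP <-].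
have sz : size (rev (belast u p)) == k.
  by rewrite size_rev size_belast size_tuple.
have revE : last u p :: rev (belast u p) = rev (u :: p).
  by rewrite [in RHS]lastI rev_rcons.
apply/existsP; exists (Tuple sz); apply/and3P; split=> /=.
- by rewrite rev_path (eq_path (e' := e)) // => x1 y1; exact: e_sym.
- by move: unp; rewrite -rev_uniq -revE.
- by have /= := congr1 (last u) revE; rewrite rev_cons last_rcons => ->.
Qed.

Lemma gdist0 x : gdist e x x = 0%N.
Proof. exact: (@gdist_shortest x [::]). Qed.

Lemma gdist1 x y : e x y -> gdist e x y = 1%N.
Proof.
move=> exy; apply: (@gdist_shortest x [:: y]) => /=; first by rewrite exy.
  by rewrite inE andbT; apply: contraTneq exy => ->; rewrite e_irr.
by case=> //= _ xy; move: exy; rewrite -xy e_irr.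
Qed.

Lemma gdist2 x y z : x != y -> ~~ e x y -> e x z -> e z y -> gdist e x y = 2%N.
Proof.
move=> xy nexy xz zy; apply: (@gdist_shortest x [:: z; y]) => /=.
- by rewrite xz zy.
- rewrite !inE negb_or xy !andbT; apply/andP; split.
    by apply: contraTneq xz => ->; rewrite e_irr.
  by apply: contraTneq zy => ->; rewrite e_irr.
case=> [_ /= xy'|u [|v q]] //=; first by rewrite xy' eqxx in xy.
by rewrite andbT => exu uy; rewrite -uy exu in nexy.
Qed.

Lemma gdist3 x y z t : x != y -> ~~ e x y -> (forall u, e x u -> ~~ e u y) ->
  e x z -> e z t -> e t y -> gdist e x y = 3%N.
Proof.
move=> xy nexy nxy xz zt ty; apply: (@gdist_shortest x [:: z; t; y]) => /=.
- by rewrite xz zt ty.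
- rewrite !inE !negb_or xy !andbT -!andbA; apply/and5P; split.
  + by apply: contraTneq xz => ->; rewrite e_irr.
  + by apply: contraNneq nexy => ->.
  + by apply: contraTneq zt => ->; rewrite e_irr.
  + by apply: contraNneq nexy => <-.
  + by apply: contraTneq ty => ->; rewrite e_irr.
case=> [_ /= xy'|u [|v [|w q]]] //=; first by rewrite xy' eqxx in xy.
  by rewrite andbT => exu uy; rewrite -uy exu in nexy.
by case/and3P=> exu euv _ vy; rewrite -vy in nxy; case/negP: (nxy _ exu).
Qed.

End Distance.

(** * Cliques, blocks and minimal vertex separators *)

Section Blocks.
Variables (T : finType) (e : rel T).
Hypotheses (e_sym : symmetric e) (e_irr : irreflexive e).
Implicit Types (x y z t : T) (S B M K L : {set T}).

Definition clique S := {in S &, forall x y, x != y -> e x y}.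

Lemma clique_connect S x y :
  clique S -> x \in S -> y \in S -> connect (induced e S) x y.
Proof.
move=> cS xS yS; have [->|xy] := eqVneq x y; first exact: connect0.
by apply: connect1; rewrite /induced /= xS yS cS.
Qed.

Lemma gdist_clique S x y :
  clique S -> x \in S -> y \in S -> gdist e x y = (x != y).
Proof.
move=> cS xS yS; have [->|xy] := eqVneq x y; first exact: gdist0.
by apply: gdist1 => //; exact: cS.
Qed.

(** On a clique the distance matrix is the all-ones matrix minus the identity. *)
Lemma clique_form (R : pzRingType) (z : T -> R) S : clique S ->
  \sum_(x in S) \sum_(y in S) (gdist e x y)%:R * z x * z y =
  (\sum_(x in S) z x) ^+ 2 - \sum_(x in S) z x ^+ 2.
Proof.
move=> cS; rewrite expr2 big_distrl -sumrB; apply: eq_bigr => x xS /=.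
rewrite (bigD1 x) //= (gdist_clique cS) // eqxx !mul0r add0r.
rewrite [X in _ * X](bigD1 x) //= mulrDr expr2 [X in X - _]addrC addrK.
rewrite big_distrr /=.
apply: eq_bigr => y /andP[yS yx].
by rewrite (gdist_clique cS) // eq_sym yx mul1r.
Qed.

(** A nonempty clique is connected without cut vertex, so it extends to a maximal such set. Applied
    to vertices, edges and a triangle, this locates them in the given blocks. *)
Lemma clique_sub_block S :
  S != set0 -> clique S -> exists2 B, block e B & S \subset B.
Proof.
move=> S0 cS; pose nonsep B := conn_in e B && [forall x, ~~ cut_vertex e B x].
suff /(@maxset_exists _ nonsep)[B] : nonsep S by exists B.
rewrite /nonsep /conn_in S0; apply/andP; split.
  apply/forall_inP => x xS; apply/forall_inP => y yS; exact: clique_connect.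
apply/forallP => x; apply/negP => /andP[_ /exists_inP[a aS]].
case/exists_inP=> b bS /andP[_ /negP[]]; apply: clique_connect => //.
by move=> y z /setD1P[_ yS] /setD1P[_ zS]; exact: cS.
Qed.

Lemma induces_clique p S : induces e (@complete p) S -> clique S.
Proof.
case=> f [f_inj -> fE] _ _ /imsetP[i _ ->] /imsetP[j _ ->].
by rewrite fE inj_eq.
Qed.

(** Outside [M], the vertex [x] would survive the deletion and still join all remaining vertices. *)
Lemma dominating_in_mvs B M x :
  mvs e B M -> x \in B -> {in B, forall y, y != x -> e x y} -> x \in M.
Proof.
case/existsP=> a /existsP[b /minsetp/and5P[aB bB _ _ /negP ab]] xB domx.
apply/negPn/negP => xM; apply: ab.
have conn y : y \in B :\: M -> connect (induced e (B :\: M)) x y.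
  move=> yB; have [->|yx] := eqVneq y x; first exact: connect0.
  apply: connect1; rewrite /induced /= yB domx ?inE ?xM ?xB //.
  by case/setDP: yB.
apply: connect_trans (conn b bB).
rewrite sym_connect_sym ?conn // => y z; rewrite /induced /=.
by rewrite andbCA e_sym.
Qed.

End Blocks.

(** * The shape of a triple block graph and the distances in it *)

Section Shape.
Variables (T U : finType) (e : rel T) (g : rel U) (a b : U).

(* [f] embeds the full house or diamond [g], the core of the graph; the cliques
   [K] and [L] contain their attachment vertices [f a] and [f b]. *)
Record cliques_on (f : U -> T) (K L : {set T}) : Prop := CliquesOn {
  core_inj : injective f;
  core_edge : forall i j, e (f i) (f j) = g i j;
  left_clique : clique e K;
  right_clique : clique e L;
  left_core : forall i, (f i \in K) = (i == a);
  right_core : forall i, (f i \in L) = (i == b);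
  left_right : forall x, x \in K -> x \notin L;
  cover : forall x, [|| x \in K, x \in L | x \in codom f];
  edge_cover : forall x y, e x y ->
    [|| (x \in K) && (y \in K), (x \in L) && (y \in L)
      | (x \in codom f) && (y \in codom f)]
}.

End Shape.

(** This symmetry transfers facts about the left clique to the right one. *)
Lemma cliques_on_swap (T U : finType) (e : rel T) (g : rel U) a b f K L :
  cliques_on e g a b f K L -> cliques_on e g b a f L K.
Proof.
case=> f_inj fE cK cL fK fL KL cov ecov; split=> //.
- by move=> x xL; apply: contraL xL; exact: KL.
- by move=> x; rewrite orbCA.
- by move=> x y /ecov; rewrite orbCA.
Qed.

Section Pt2Shape.
Variables (T : finType) (e : rel T).
Hypotheses (e_sym : symmetric e) (e_irr : irreflexive e).

(** Since [a] and [b] dominate the core, their images lie in the separator, hence are [u] and [v] in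
    some order. If the order is reversed, the two cliques exchange roles, which is why [K'] and [L']
    are existential. *)
Lemma blocks_cliques_on (U : finType) (g : rel U) (a b : U)
    (B K L : {set T}) u v :
  a != b -> (forall j, j != a -> g a j) -> (forall j, j != b -> g b j) ->
  [set S | block e S] = [set B; K; L] -> induces e g B ->
  clique e K -> clique e L ->
  u != v -> mvs e B [set u; v] -> B :&: K = [set u] -> B :&: L = [set v] ->
  exists f K' L', cliques_on e g a b f K' L'.
Proof.
move=> ab doma domb blocks [f [f_inj BE fE]] cK cL uv mB BK BL.
have fB i : f i \in B by rewrite BE imset_f.
have domB c : (forall j, j != c -> g c j) -> f c \in [set u; v].
  move=> domc; apply: dominating_in_mvs mB (fB c) _ => //.
  move=> _ /[!BE]/imsetP[j _ ->]; rewrite inj_eq // fE; exact: domc.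
have in_block S : S != set0 -> clique e S ->
    [|| S \subset B, S \subset K | S \subset L].
  move=> S0 cS; have [A bA SA] := clique_sub_block S0 cS.
  have : A \in [set S | block e S] by rewrite inE.
  by rewrite blocks !inE => /orP[/orP[]|] /eqP <-; rewrite SA ?orbT.
have inBK x : x \in B -> (x \in K) = (x == u).
  by move=> xB; rewrite -in_set1 -BK inE xB.
have inBL x : x \in B -> (x \in L) = (x == v).
  by move=> xB; rewrite -in_set1 -BL inE xB.
have uB : u \in B by have := set11 u; rewrite -BK => /setIP[].
have vB : v \in B by have := set11 v; rewrite -BL => /setIP[].
have uK : u \in K by rewrite inBK.
have vL : v \in L by rewrite inBL.
have codomB x : (x \in codom f) = (x \in B).
  by rewrite BE; apply/codomP/imsetP => [[i ->]|[i _ ->]]; exists i.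
have fE2 : (f a == u) && (f b == v) || (f a == v) && (f b == u).
  have nab : f a != f b by rewrite inj_eq.
  move: (domB a doma) (domB b domb) nab; rewrite !inE.
  by move=> /orP[]/eqP-> /orP[]/eqP->; rewrite !eqxx ?orbT.
have euv : e u v.
  case/orP: fE2 => /andP[/eqP<- /eqP<-]; rewrite fE.
    by rewrite doma // eq_sym.
  by rewrite domb.
(* A common vertex of K and L would form a triangle with u and v, which lies in
   no block. *)
have KL x : x \in K -> x \notin L.
  move=> xK; apply/negP => xL.
  have xB : x \notin B.
    apply/negP => xB; move: xK xL uv; rewrite inBK // inBL // => /eqP-> /eqP->.
    by rewrite eqxx.
  have xu : x != u by apply: contraNneq xB => ->.
  have xv : x != v by apply: contraNneq xB => ->.
  have cuvx : clique e [set x; u; v].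
    have [exu exv] : e x u /\ e x v by rewrite cK // cL.
    move=> s t; rewrite !inE => /orP[/orP[]|]/eqP-> /orP[/orP[]|]/eqP->;
      by rewrite ?eqxx // e_sym.
  have S0 : [set x; u; v] != set0.
    by apply/set0Pn; exists x; rewrite !inE eqxx.
  have := in_block _ S0 cuvx; rewrite !subUset !sub1set (negPf xB) (inBK v) //.
  by rewrite (inBL u) // [v == u]eq_sym (negPf uv) !andbF.
have cov x : [|| x \in K, x \in L | x \in codom f].
  have := @in_block [set x]; rewrite !sub1set codomB orbC -orbA; apply.
    by apply/set0Pn; exists x; rewrite inE.
  by move=> y z /set1P-> /set1P->; rewrite eqxx.
(* An edge is a clique with two vertices, so it lies inside one of the three blocks. *)
have ecov x y : e x y -> [|| (x \in K) && (y \in K), (x \in L) && (y \in L)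
      | (x \in codom f) && (y \in codom f)].
  move=> exy; have := @in_block [set x; y].
  rewrite !subUset !sub1set !codomB orbC -orbA; apply.
    by apply/set0Pn; exists x; rewrite !inE eqxx.
  move=> s t /set2P[]-> /set2P[]->; rewrite ?eqxx // => _ //.
  by rewrite e_sym.
case/orP: fE2 => /andP[/eqP fa /eqP fb].
  exists f, K, L; split=> // i.
  - by rewrite inBK // -fa inj_eq.
  - by rewrite inBL // -fb inj_eq.
exists f, L, K; apply: cliques_on_swap; split=> // i.
- by rewrite inBK // -fb inj_eq.
- by rewrite inBL // -fa inj_eq.
Qed.
End Pt2Shape.

(** This is the graph distance when [g] is symmetric, irreflexive and has a dominating vertex:
    nonadjacent vertices are then at distance 2. *)
Definition core_dist (U : finType) (g : rel U) (i j : U) : nat :=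
  if i == j then 0%N else if g i j then 1%N else 2%N.

Section ShapeDist.
Variables (T U : finType) (e : rel T) (g : rel U) (a b : U).
Variables (f : U -> T) (K L : {set T}).
Hypotheses (e_sym : symmetric e) (e_irr : irreflexive e).
Hypotheses (doma : forall j, j != a -> g a j).
Hypothesis H : cliques_on e g a b f K L.

Lemma left_codom x : x \in K :\ f a -> x \notin codom f.
Proof.
case/setD1P=> xa xK; apply/codomP => -[i xi].
by move: xK xa; rewrite xi (left_core H) => /eqP->; rewrite eqxx.
Qed.

(** The vertex [x] lies neither in [L] nor in the core, so [edge_cover] leaves only [K]: every way
    out of the clique passes through [f a]. *)
Lemma left_edge x y : x \in K :\ f a -> e x y -> y \in K.
Proof.
move=> xK' exy; case/orP: (edge_cover H exy) => [/andP[]//|].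
case/setD1P: (xK') => _ xK; rewrite (negPf (left_right H xK)) /=.
by rewrite (negPf (left_codom xK')).
Qed.

Lemma gdist_core i j : gdist e (f i) (f j) = core_dist g i j.
Proof.
rewrite /core_dist; have [->|ij] := eqVneq i j; first exact: gdist0.
have fE := core_edge H.
case: ifP => gij; first by apply: gdist1; rewrite ?fE.
have ia : i != a.
  by apply: contraFneq gij => ia; rewrite ia doma // -ia eq_sym.
have ja : j != a.
  by apply: contraFneq gij => ja; rewrite ja -fE e_sym fE doma // -ja.
apply: (@gdist2 _ _ _ _ _ (f a)) => //.
- by rewrite (inj_eq (core_inj H)).
- by rewrite fE gij.
- by rewrite e_sym fE doma.
- by rewrite fE doma.
Qed.

(** The attachment vertex [f a] is a neighbour of [x], and every other core vertex is one step
    beyond it. *)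
Lemma gdist_left_core x i : x \in K :\ f a ->
  gdist e x (f i) = (i != a).+1.
Proof.
move=> xK'; case/setD1P: (xK') => xa xK.
have aK : f a \in K by rewrite (left_core H).
have [->|ia] := eqVneq i a; first by
  rewrite (gdist_clique e_irr (left_clique H)) // xa.
apply: (@gdist2 _ _ _ _ _ (f a)) => //.
- by apply: contraNneq (left_codom xK') => ->; exact: codom_f.
- by apply: contra ia => /(left_edge xK'); rewrite (left_core H).
- exact: (left_clique H).
- by rewrite (core_edge H) doma.
Qed.

End ShapeDist.

(** * The quadratic form of the distance matrix *)

Section DistanceForm.
Variables (T U : finType) (e : rel T) (g : rel U) (a b : U).
Variables (f : U -> T) (K L : {set T}).
Hypotheses (e_sym : symmetric e) (e_irr : irreflexive e).
Hypotheses (ab : a != b) (doma : forall j, j != a -> g a j).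
Hypothesis H : cliques_on e g a b f K L.
Let K' := K :\ f a.
Let L' := L :\ f b.

(** A shortest path runs through [f a] and [f b]. All neighbours of [x] are in [K], and no vertex of
    [K] is adjacent to [y], which excludes length 2. *)
Lemma gdist_left_right x y : x \in K' -> y \in L' -> gdist e x y = 3%N.
Proof.
move=> xK' yL'; have H' := cliques_on_swap H.
have [xa xK] := setD1P xK'; have [yb yL] := setD1P yL'.
have nxy z : z \in K -> ~~ e z y.
  move=> zK; apply/negP; rewrite e_sym => /(left_edge H' yL').
  by rewrite (negPf (left_right H zK)).
apply: (@gdist3 _ _ _ _ _ (f a) (f b)) => //.
- by apply: contraTneq yL => <-; exact: (left_right H).
- exact: nxy.
- by move=> z /(left_edge H xK'); exact: nxy.
- by apply: (left_clique H); rewrite // (left_core H).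
- by rewrite (core_edge H) doma // eq_sym.
- by apply: (right_clique H); rewrite // 1?(right_core H) // eq_sym.
Qed.

(** The attachment vertices are counted in the core, so [K'], [L'] and the core partition the
    graph. *)
Lemma sum_cliques_on (V : nmodType) (F : T -> V) :
  \sum_x F x = \sum_(x in K') F x + \sum_(x in L') F x + \sum_i F (f i).
Proof.
rewrite (bigID (mem K')) /= -addrA; congr (_ + _).
rewrite (bigID (mem L')) /=; congr (_ + _).
  apply: eq_bigl => x; case: (boolP (x \in L')) => xL'; rewrite ?andbF // andbT.
  apply: contraTN xL' => /setD1P[_ /(left_right H) xL].
  by rewrite inE (negPf xL) andbF.
rewrite (eq_bigl (mem [set f i | i in U])); last first.
  move=> x; apply/andP/imsetP => [[xK xL]|[i _ ->]]; last first.
    rewrite !inE (left_core H) (right_core H) !(inj_eq (core_inj H)).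
    by rewrite !andNb.
  move: (cover H x) xK xL; rewrite !inE.
  case/or3P=> [-> |->|/codomP[i ->] _ _]; last by exists i.
    by rewrite andbT negbK => /eqP-> _; exists a.
  by rewrite andbT negbK => _ /eqP->; exists b.
by rewrite big_imset //= => i j _ _; exact: (core_inj H).
Qed.

Lemma left_core_form (R : comPzRingType) (z : T -> R) :
  \sum_(x in K') \sum_i (gdist e x (f i))%:R * z x * z (f i) =
  (\sum_(x in K') z x) * \sum_i (i != a).+1%:R * z (f i).
Proof.
rewrite big_distrl; apply: eq_bigr => x xK /=; rewrite big_distrr.
apply: eq_bigr => i _ /=; rewrite (gdist_left_core e_irr doma H) //; ring.
Qed.

Lemma left_right_form (R : comPzRingType) (z : T -> R) :
  \sum_(x in K') \sum_(y in L') (gdist e x y)%:R * z x * z y =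
  3 * (\sum_(x in K') z x) * \sum_(y in L') z y.
Proof.
rewrite [3 * _]big_distrr big_distrl; apply: eq_bigr => x xK /=.
rewrite big_distrr.
by apply: eq_bigr => y yL /=; rewrite gdist_left_right.
Qed.
End DistanceForm.

(** The double sum splits into nine parts over [K'], [L'] and the core. By symmetry ([flip]) the
    off-diagonal ones pair up, whence the factors 2 and 6 = 2 * 3. *)
Lemma distance_form (T U : finType) (e : rel T) (g : rel U) a b f K L
    (R : comPzRingType) (z : T -> R) :
  symmetric e -> irreflexive e -> a != b ->
  (forall j, j != a -> g a j) -> (forall j, j != b -> g b j) ->
  cliques_on e g a b f K L ->
  let sK := \sum_(x in K :\ f a) z x in let sL := \sum_(x in L :\ f b) z x in
  \sum_x \sum_y (gdist e x y)%:R * z x * z y =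
  sK ^+ 2 - \sum_(x in K :\ f a) z x ^+ 2
  + (sL ^+ 2 - \sum_(x in L :\ f b) z x ^+ 2)
  + 6 * sK * sL
  + 2 * sK * (\sum_i (i != a).+1%:R * z (f i))
  + 2 * sL * (\sum_i (i != b).+1%:R * z (f i))
  + \sum_i \sum_j (core_dist g i j)%:R * z (f i) * z (f j).
Proof.
move=> e_sym e_irr ab doma domb H sK sL; have H' := cliques_on_swap H.
have sub_clique S u : clique e S -> clique e (S :\ u).
  by move=> cS x y /setD1P[_ xS] /setD1P[_ yS]; exact: cS.
have flip (V W : finType) (P : pred V) (Q : pred W) (h : V -> T) (k : W -> T) :
    \sum_(x | P x) \sum_(y | Q y) (gdist e (h x) (k y))%:R * z (h x) * z (k y) =
    \sum_(y | Q y) \sum_(x | P x) (gdist e (k y) (h x))%:R * z (k y) * z (h x).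
  rewrite exchange_big; apply: eq_bigr => y _; apply: eq_bigr => x _ /=.
  by rewrite gdist_sym // mulrAC.
have split3 h : \sum_y h y = \sum_(y in K :\ f a) h y + \sum_(y in L :\ f b) h y
    + \sum_i h (f i) :> R by exact: (sum_cliques_on H).
rewrite (eq_bigr _ (fun x _ => split3 _)) split3 !big_split /=.
rewrite (flip _ _ (mem (L :\ f b)) (mem (K :\ f a)) id id).
rewrite (flip _ _ xpredT (mem (K :\ f a)) f id).
rewrite (flip _ _ xpredT (mem (L :\ f b)) f id) /=.
rewrite (clique_form e_irr z (sub_clique _ (f a) (left_clique H))).
rewrite (clique_form e_irr z (sub_clique _ (f b) (right_clique H))).
rewrite (left_right_form e_sym e_irr ab doma H) (left_core_form e_irr doma H).
rewrite (left_core_form e_irr domb H').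
have -> : \sum_i \sum_j (gdist e (f i) (f j))%:R * z (f i) * z (f j) =
    \sum_i \sum_j (core_dist g i j)%:R * z (f i) * z (f j).
  apply: eq_bigr => i _; apply: eq_bigr => j _.
  by rewrite (gdist_core e_sym e_irr doma H).
rewrite -/sK -/sL; ring.
Qed.

(** * Negativity of the form on the hyperplane, for each core *)

Section CoreForm.
Variables (R : realFieldType) (U : finType) (g : rel U) (a b : U).

(* What remains of the form of D + 1/2 after the nonpositive multiples of the
   squares off the core are dropped. *)
Definition core_form (p q : R) (y : U -> R) : R :=
  p ^+ 2 + q ^+ 2 + 6 * p * q
  + 2 * p * (\sum_i (i != a).+1%:R * y i)
  + 2 * q * (\sum_i (i != b).+1%:R * y i)
  + \sum_i \sum_j (core_dist g i j)%:R * y i * y j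
  + (\sum_i y i ^+ 2) / 2.

Definition core_weight (i : U) : R := if (i == a) || (i == b) then 3 else 4.

(** The case of equality is only stated for [p = q = 0]: the squares off the core give strictness
    unless the vector vanishes there. *)
Definition core_negative : Prop :=
  forall p q y, 4 * (p + q) + \sum_i core_weight i * y i = 0 ->
  core_form p q y <= 0 /\
  (p = 0 -> q = 0 -> core_form p q y = 0 -> forall i, y i = 0).

End CoreForm.

(** The squares come from successive completion: the linear form absorbs [p + q], [c1] the part
    antisymmetric in the two sides, [c2] absorbs [u + v], and [c3], [c4] diagonalize the rest in
    [w1] and [w2]. *)
Lemma diamond_negative (R : realFieldType) :
  @core_negative R _ diamond ord0 (lift ord0 ord0).
Proof.
move=> p q y; set u := y ord0; set v := y (lift ord0 ord0).
set w1 := y (lift ord0 (lift ord0 ord0)).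
set w2 := y (lift ord0 (lift ord0 (lift ord0 ord0))).
pose c1 := p - q + (u - v) / 2; pose c2 := (u + v) / 2 + 2 / 3 * (w1 + w2).
pose c3 := w1 + w2; pose c4 := w1 - w2.
have -> : core_form diamond ord0 (lift ord0 ord0) p q y =
    (4 * (p + q) + \sum_i core_weight R ord0 (lift ord0 ord0) i * y i) ^+ 2 / 8
    - (c1 ^+ 2 + 3 / 2 * c2 ^+ 2 + 1 / 12 * c3 ^+ 2 + 3 / 4 * c4 ^+ 2).
  rewrite /core_form /core_weight !big_ord_recl !big_ord0 /core_dist /=.
  by rewrite -/u -/v -/w1 -/w2 /c1 /c2 /c3 /c4; field.
have [[[s1 s2] s3] s4] := (sqr_ge0 c1, sqr_ge0 c2, sqr_ge0 c3, sqr_ge0 c4).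
move=> ->; split; first lra.
move=> p0 q0 S0.
have {s1 s2 s3 s4 S0}[z1 z2 z3 z4] : [/\ c1 = 0, c2 = 0, c3 = 0 & c4 = 0].
  by split; apply/eqP; rewrite -sqrf_eq0 eq_le; apply/andP; split; lra.
rewrite /c1 /c2 /c3 /c4 in z1 z2 z3 z4.
move=> i; case: (unliftP ord0 i) => [{}i ->|->]; last by rewrite -/u; lra.
case: (unliftP ord0 i) => [{}i ->|->]; last by rewrite -/v; lra.
case: (unliftP ord0 i) => [{}i ->|->]; last by rewrite -/w1; lra.
by case: (unliftP ord0 i) => [[//]|->]; rewrite -/w2; lra.
Qed.

(** The completion starts as for the diamond. In the rest, [c4] is antisymmetric in the twins [w1],
    [w2], while [c3] absorbs [w1 + w2] and leaves a multiple of [w3 ^+ 2]. *)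
Lemma full_house_negative (R : realFieldType) :
  @core_negative R _ full_house ord0 (lift ord0 ord0).
Proof.
move=> p q y; set u := y ord0; set v := y (lift ord0 ord0).
set w1 := y (lift ord0 (lift ord0 ord0)).
set w2 := y (lift ord0 (lift ord0 (lift ord0 ord0))).
set w3 := y (lift ord0 (lift ord0 (lift ord0 (lift ord0 ord0)))).
pose c1 := p - q + (u - v) / 2; pose c2 := (u + v) / 2 + 2 / 3 * (w1 + w2 + w3).
pose c3 := w1 + w2 - 8 / 7 * w3; pose c4 := w1 - w2.
have -> : core_form full_house ord0 (lift ord0 ord0) p q y =
    (4 * (p + q) + \sum_i core_weight R ord0 (lift ord0 ord0) i * y i) ^+ 2 / 8
    - (c1 ^+ 2 + 3 / 2 * c2 ^+ 2 + 7 / 12 * c3 ^+ 2 + 1 / 4 * c4 ^+ 2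
       + 1 / 14 * w3 ^+ 2).
  rewrite /core_form /core_weight !big_ord_recl !big_ord0 /core_dist /=.
  by rewrite -/u -/v -/w1 -/w2 -/w3 /c1 /c2 /c3 /c4; field.
have [[s1 s2] s3] := (sqr_ge0 c1, sqr_ge0 c2, sqr_ge0 c3).
have [s4 s5] := (sqr_ge0 c4, sqr_ge0 w3).
move=> ->; split; first lra.
move=> p0 q0 S0.
have {s1 s2 s3 s4 s5 S0}[z1 z2 z3 z4 z5] :
    [/\ c1 = 0, c2 = 0, c3 = 0, c4 = 0 & w3 = 0].
  by split; apply/eqP; rewrite -sqrf_eq0 eq_le; apply/andP; split; lra.
rewrite /c1 /c2 /c3 /c4 in z1 z2 z3 z4.
move=> i; case: (unliftP ord0 i) => [{}i ->|->]; last by rewrite -/u; lra.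
case: (unliftP ord0 i) => [{}i ->|->]; last by rewrite -/v; lra.
case: (unliftP ord0 i) => [{}i ->|->]; last by rewrite -/w1; lra.
case: (unliftP ord0 i) => [{}i ->|->]; last by rewrite -/w2; lra.
by case: (unliftP ord0 i) => [[//]|->]; rewrite -/w3; lra.
Qed.

(** * The eigenvalue bound, from the core to the whole graph *)

Lemma second_distance_eigenvalue_lt (R : rcfType) n (e : rel 'I_n)
    (U : finType) (g : rel U) (a b : U) f K L :
  symmetric e -> irreflexive e -> a != b ->
  (forall j, j != a -> g a j) -> (forall j, j != b -> g b j) ->
  core_negative R g a b -> cliques_on e g a b f K L ->
  (eigenvalues (distmx R e))`_1 < - (1 / 2).
Proof.
move=> e_sym e_irr ab doma domb neg H.
pose w : 'cV[R]_n := \col_k (if (k == f a) || (k == f b) then 3 else 4).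
apply: (@second_eigenvalue_lt _ _ _ w).
- rewrite -[n]card_ord -cardsT.
  apply: leq_trans (subset_leq_card (subsetT [set f a; f b])).
  by rewrite cards2 (inj_eq (core_inj H)) ab.
- by apply/matrixP => i j; rewrite !mxE gdist_sym.
move=> x x0 xw; pose z i := x 0 i.
have -> : (x *m distmx R e *m x^T) 0 0 =
    \sum_i \sum_j (gdist e i j)%:R * z i * z j.
  rewrite mxE exchange_big; apply: eq_bigr => j _; rewrite !mxE big_distrl.
  by apply: eq_bigr => i _; rewrite !mxE /z [_ * x 0 i]mulrC.
have -> : (x *m x^T) 0 0 = \sum_i z i ^+ 2.
  by rewrite mxE; apply: eq_bigr => i _; rewrite mxE.
have {xw} : \sum_i w i 0 * z i = 0.
  transitivity ((x *m w) 0 0); last by rewrite xw mxE.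
  by rewrite mxE; apply: eq_bigr => i _; rewrite mulrC.
rewrite (distance_form z e_sym e_irr ab doma domb H).
rewrite !(sum_cliques_on H).
set sK := \sum_(i in K :\ f a) z i; set sL := \sum_(i in L :\ f b) z i.
set nK := \sum_(i in K :\ f a) z i ^+ 2.
set nL := \sum_(i in L :\ f b) z i ^+ 2.
have nK0 : 0 <= nK by apply: sumr_ge0 => i _; exact: sqr_ge0.
have nL0 : 0 <= nL by apply: sumr_ge0 => i _; exact: sqr_ge0.
have weightK : \sum_(i in K :\ f a) w i 0 * z i = 4 * sK.
  rewrite big_distrr; apply: eq_bigr => i /setD1P[ia iK].
  rewrite mxE (negPf ia).
  have /negPf -> // : i != f b.
  by apply: contraTneq iK => ->; rewrite (left_core H) eq_sym.
have weightL : \sum_(i in L :\ f b) w i 0 * z i = 4 * sL.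
  rewrite big_distrr; apply: eq_bigr => i /setD1P[ib iL].
  rewrite mxE (negPf ib) orbF.
  have /negPf -> // : i != f a.
  by apply: contraTneq iL => ->; rewrite (right_core H).
have weightB :
    \sum_i w (f i) 0 * z (f i) = \sum_i core_weight R a b i * z (f i).
  by apply: eq_bigr => i _; rewrite mxE !(inj_eq (core_inj H)).
rewrite weightK weightL weightB -mulrDr => h0.
have [le0 eq0] := neg sK sL (z \o f) h0.
(* Squares off the core have coefficient -1 in the distance form, hence -1/2 after the shift by 1/2;
   a positive [nL] or [nK] thus makes [le0] strict. *)
have [nL1|nL1] := eqVneq nL 0; last first.
  have : 0 < nL by rewrite lt_def nL1.
  rewrite /core_form /= in le0; lra.
have [nK1|nK1] := eqVneq nK 0; last first.
  have : 0 < nK by rewrite lt_def nK1.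
  rewrite /core_form /= in le0; lra.
have zero (S : {set 'I_n}) i : \sum_(i in S) z i ^+ 2 = 0 -> i \in S -> z i = 0.
  move=> S0 iS; apply/eqP; rewrite -sqrf_eq0; apply/eqP.
  by apply: (psumr_eq0P _ S0) => // j _; exact: sqr_ge0.
have sum0 (S : {set 'I_n}) :
    \sum_(i in S) z i ^+ 2 = 0 -> \sum_(i in S) z i = 0.
  by move=> S0; apply: big1 => i iS; exact: zero S0 iS.
have sK0 : sK = 0 by exact: sum0.
have sL0 : sL = 0 by exact: sum0.
(* Now [z] vanishes off the core, so equality would make it vanish everywhere. *)
have lt0 : core_form g a b sK sL (z \o f) < 0.
  rewrite lt_def le0 andbT eq_sym; apply: contra_neq x0 => c0.
  have y0 := eq0 sK0 sL0 c0.
  apply/rowP => i; rewrite mxE -/(z i).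
  case/or3P: (cover H i) => [iK|iL|/codomP[j ->]]; last exact: y0.
    have [->|ia] := eqVneq i (f a); first exact: y0.
    by apply: (zero _ _ nK1); rewrite !inE ia.
  have [->|ib] := eqVneq i (f b); first exact: y0.
  by apply: (zero _ _ nL1); rewrite !inE ib.
rewrite /core_form /= in lt0; lra.
Qed.

Theorem theorem5 (R : rcfType) (r n : nat) (e : rel 'I_n) :
  (2 <= r)%N -> symmetric e -> irreflexive e -> conn_graph e ->
  Pt2 e r r ->
  (eigenvalues (distmx R e))`_1 < - (1 / 2).
Proof.
move=> _ e_sym e_irr _ [B [K [L [_ blocks coreB [iK iL]]]]].
have [cK cL] := (induces_clique iK, induces_clique iL).
case=> u [v [uv mB BK BL]]; case: coreB => coreB.
- have doma (j : 'I_5) : j != ord0 -> full_house ord0 j.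
    by case: j => [[|j] ij] //; rewrite /full_house /= /minn /= orbT.
  have domb (j : 'I_5) : j != lift ord0 ord0 -> full_house (lift ord0 ord0) j.
    by case: j => [[|[|j]] ij] //; rewrite /full_house /= /minn /= orbT.
  have [//|f [K' [L' H]]] :=
    blocks_cliques_on e_sym _ doma domb blocks coreB cK cL uv mB BK BL.
  apply: second_distance_eigenvalue_lt doma domb _ H => //.
  exact: full_house_negative.
- have doma (j : 'I_4) : j != ord0 -> diamond ord0 j.
    by case: j => [[|j] ij].
  have domb (j : 'I_4) : j != lift ord0 ord0 -> diamond (lift ord0 ord0) j.
    by case: j => [[|[|j]] ij].
  have [//|f [K' [L' H]]] :=
    blocks_cliques_on e_sym _ doma domb blocks coreB cK cL uv mB BK BL.
  apply: second_distance_eigenvalue_lt doma domb _ H => //.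
  exact: diamond_negative.
Qed.
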